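(* Let $0<q<1$ and $$\tilde f(\mu;x)=\frac{{}_2\phi_1(0,0;q^\mu;x)}{\Gamma_q(\mu)}=\sum_{n=0}^\infty\frac{[x/(1-q)]^n}{\Gamma_q(\mu+n)\,(q;q)_n}.$$ Then for all $\mu,\alpha,\beta>0$ the coefficients of the power series expansion (in $x$) of the generalized Turánian $$\Delta_{\tilde f}(\alpha,\beta;x)=\tilde f(\mu+\alpha;x)\tilde f(\mu+\beta;x)-\tilde f(\mu;x)\tilde f(\mu+\alpha+\beta;x)$$ are positive. In particular, for each $0<x<1$ the function $\mu\mapsto\tilde f(\mu;x)$ is log-concave on $[0,\infty)$.
   Context: The $q$-shifted factorial is $(a;q)_0=1$, $(a;q)_n=\prod_{k=0}^{n-1}(1-aq^k)$ for $n\ge1$, $(a;q)_\infty=\lim_{n\to\infty}(a;q)_n$. The $q$-gamma function is $\Gamma_q(z)=(1-q)^{1-z}\frac{(q;q)_\infty}{(q^z;q)_\infty}$. Heine's series here is ${}_2\phi_1(0,0;q^\mu;x)=\sum_{n\ge0}\frac{x^n}{(q^\mu;q)_n(q;q)_n}$, $|x|<1$. At $\mu=0$ the function $\tilde f(0;x)$ is understood through the second series with $1/\Gamma_q(0)=0$. *)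

(* Defs.v *)
From Stdlib Require Import Reals.
From Coquelicot Require Import Coquelicot.
Open Scope R_scope.

Fixpoint qpoch (a q : R) (n : nat) : R :=
  match n with
  | O => 1
  | S k => qpoch a q k * (1 - a * q ^ k)
  end.

Definition qpoch_inf (a q : R) : R := real (Lim_seq (qpoch a q)).

Definition qGamma (q z : R) : R :=
  Rpower (1 - q) (1 - z) * (qpoch_inf q q / qpoch_inf (Rpower q z) q).

(* 1 / qGamma q z for z >= 0: qGamma has a pole at z = 0, where the reciprocal
   takes the value 0. *)
Definition inv_qGamma (q z : R) : R :=
  if Req_EM_T z 0 then 0 else / qGamma q z.

(* The series 2phi1(0,0;b;x) with base q. *)
Definition heine00 (q b x : R) : R :=
  Series (fun n => x ^ n / (qpoch b q n * qpoch q q n)).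

(* The second series for ftilde is taken as the definition because it is
   meaningful for every mu >= 0, whereas 2phi1(0,0;q^mu;x) / Gamma_q(mu) is
   undefined at mu = 0. *)
Definition ftilde (q mu x : R) : R :=
  Series (fun n => (x / (1 - q)) ^ n * inv_qGamma q (mu + INR n) / qpoch q q n).

Definition turanian (f : R -> R -> R) (mu alpha beta x : R) : R :=
  f (mu + alpha) x * f (mu + beta) x - f mu x * f (mu + alpha + beta) x.

(* Positivity on D is required explicitly since Stdlib's ln is 0 on
   nonpositive reals. *)
Definition log_concave_on (D : R -> Prop) (g : R -> R) : Prop :=
  (forall u, D u -> 0 < g u) /\
  (forall u v t, D u -> D v -> 0 <= t <= 1 ->
     t * ln (g u) + (1 - t) * ln (g v) <= ln (g (t * u + (1 - t) * v))).

(* Main.v *)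
Require Import Defs.
From Stdlib Require Import Reals Lra Lia.
From Coquelicot Require Import Coquelicot.
Open Scope R_scope.

(* With b = q^mu and G(b;x) = sum_n (b q^n;q)_oo x^n / (q;q)_n one has
   ftilde(mu;x) = (1-q)^(mu-1) / (q;q)_oo * G(b;x), also at mu = 0. The product is

     G(a;x) G(c;x) = 1/(x;q)_oo *
       sum_i (a c q^(i-1);q)_i (a q^i;q)_oo (c q^i;q)_oo x^i / (q;q)_i,

   a form of the q-Chu-Vandermonde sum, proved on coefficients by induction from
   the q-Pascal rule and a q^(i-1) (a q^i;q)_oo = (a q^i;q)_oo - (a q^(i-1);q)_oo.
   Since (a c q^(i-1);q)_i depends only on ac, the Turanian, which compares the
   pairs (bA, bB) and (b, bAB) with A = q^alpha, B = q^beta, is positive term by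
   term: (1-bA)(1-bB) - (1-b)(1-bAB) = b(1-A)(1-B). Log-concavity follows from
   the case alpha = beta and the continuity of ftilde in mu. *)

(** * Finite and infinite q-shifted factorials *)

Lemma pow_01 (q : R) (n : nat) : 0 < q < 1 -> 0 < q ^ n <= 1.
Proof.
  intros hq; split; [apply pow_lt; lra|].
  rewrite <- (pow1 n); apply pow_incr; lra.
Qed.

Lemma mult_pow_01 (q a : R) (n : nat) :
  0 < q < 1 -> 0 <= a -> 0 <= a * q ^ n <= a.
Proof. intros hq ha; pose proof (pow_01 q n hq); split; nra. Qed.

Lemma pow_eventually_small (q a e : R) :
  0 < q < 1 -> 0 <= a -> 0 < e -> exists N, a * q ^ N <= e.
Proof.
  intros hq ha he.
  (* Dividing by [a + 1] instead of [a] covers [a = 0]. *)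
  assert (hy : 0 < e / (a + 1)) by (apply Rdiv_lt_0_compat; lra).
  destruct (pow_lt_1_zero q (Rabs_def1 q 1 ltac:(lra) ltac:(lra)) _ hy) as [N hN].
  exists N; specialize (hN N (le_n N)).
  pose proof (pow_01 q N hq).
  rewrite Rabs_pos_eq in hN by lra.
  apply (Rmult_lt_compat_r (a + 1)) in hN; [|lra].
  replace (e / (a + 1) * (a + 1)) with e in hN by (field; lra).
  nra.
Qed.

Lemma qpoch_shift (a q : R) (n : nat) :
  qpoch a q (S n) = (1 - a) * qpoch (a * q) q n.
Proof.
  induction n as [|n IH]; [simpl; ring|].
  change (qpoch a q (S n) * (1 - a * q ^ S n) =
          (1 - a) * (qpoch (a * q) q n * (1 - a * q * q ^ n))).
  rewrite IH; simpl; ring.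
Qed.

Lemma qpoch_01 (q a : R) (n : nat) :
  0 < q < 1 -> 0 <= a <= 1 -> 0 <= qpoch a q n <= 1.
Proof.
  intros hq ha; induction n as [|n IH]; simpl; [lra|].
  pose proof (mult_pow_01 q a n hq (proj1 ha)); split; nra.
Qed.

Lemma qpoch_pos (q a : R) (n : nat) :
  0 < q < 1 -> 0 <= a < 1 -> 0 < qpoch a q n.
Proof.
  intros hq ha; induction n as [|n IH]; simpl; [lra|].
  pose proof (mult_pow_01 q a n hq (proj1 ha)); nra.
Qed.

(** For [a <= 1] all factors lie in [0, 1], so the sequence decreases and is bounded below by 0. A
    larger [a] is reduced to this case by peeling off first factors until [a * q ^ N <= 1].
    Parameters above 1 do occur: the induction in [qconv_qpoch_inf] passes from [a] to [a / q]. *)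
Lemma ex_finite_lim_qpoch (q a : R) :
  0 < q < 1 -> 0 <= a -> ex_finite_lim_seq (qpoch a q).
Proof.
  intros hq ha; destruct (pow_eventually_small q a 1 hq ha Rlt_0_1) as [N hN].
  revert a ha hN; induction N as [|N IH]; intros a ha hN; simpl in hN.
  - apply ex_finite_lim_seq_decr with 0; intros n.
    + pose proof (qpoch_01 q a n hq ltac:(lra)).
      pose proof (mult_pow_01 q a n hq ha); simpl; nra.
    + apply qpoch_01; lra.
  - destruct (IH (a * q)) as [l hl]; [nra|rewrite Rmult_assoc; exact hN|].
    exists ((1 - a) * l); apply is_lim_seq_incr_1.
    apply is_lim_seq_ext with (fun n => (1 - a) * qpoch (a * q) q n).
    + intros n; symmetry; apply qpoch_shift.
    + exact (is_lim_seq_scal_l _ (1 - a) l hl).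
Qed.

Lemma is_lim_qpoch (q a : R) :
  0 < q < 1 -> 0 <= a -> is_lim_seq (qpoch a q) (qpoch_inf a q).
Proof.
  intros hq ha; destruct (ex_finite_lim_qpoch q a hq ha) as [l hl].
  unfold qpoch_inf; rewrite (is_lim_seq_unique _ _ hl); exact hl.
Qed.

Lemma qpoch_inf_shift (q a : R) :
  0 < q < 1 -> 0 <= a -> qpoch_inf a q = (1 - a) * qpoch_inf (a * q) q.
Proof.
  intros hq ha.
  assert (h : is_lim_seq (fun n => qpoch a q (S n)) ((1 - a) * qpoch_inf (a * q) q)).
  { apply is_lim_seq_ext with (fun n => (1 - a) * qpoch (a * q) q n).
    - intros n; symmetry; apply qpoch_shift.
    - apply (is_lim_seq_scal_l _ (1 - a) (Finite _)), is_lim_qpoch; nra. }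
  apply is_lim_seq_incr_1 in h.
  unfold qpoch_inf at 1; rewrite (is_lim_seq_unique _ _ h); reflexivity.
Qed.

Lemma qpoch_inf_split (q a : R) (n : nat) :
  0 < q < 1 -> 0 <= a ->
  qpoch_inf a q = qpoch a q n * qpoch_inf (a * q ^ n) q.
Proof.
  intros hq ha; induction n as [|n IH]; simpl.
  - rewrite Rmult_1_r; ring.
  - rewrite IH, (qpoch_inf_shift q (a * q ^ n)) by
      (try apply mult_pow_01; assumption).
    replace (a * q ^ n * q) with (a * (q * q ^ n)) by ring; ring.
Qed.

Lemma qpoch_inf_01 (q a : R) :
  0 < q < 1 -> 0 <= a <= 1 -> 0 <= qpoch_inf a q <= 1.
Proof.
  intros hq ha; pose proof (is_lim_qpoch q a hq (proj1 ha)) as h; split.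
  - apply (is_lim_seq_le (fun _ => 0) (qpoch a q) 0 (qpoch_inf a q));
      [intros n; apply qpoch_01; assumption | apply is_lim_seq_const | exact h].
  - apply (is_lim_seq_le (qpoch a q) (fun _ => 1) (qpoch_inf a q) 1);
      [intros n; apply qpoch_01; assumption | exact h | apply is_lim_seq_const].
Qed.

Lemma qpoch_lipschitz (q a b : R) (n : nat) :
  0 < q < 1 -> 0 <= a <= 1 -> 0 <= b <= 1 ->
  Rabs (qpoch a q n - qpoch b q n) <= Rabs (a - b) / (1 - q).
Proof.
  intros hq ha hb.
  (* The sharper constant 1 + q + ... + q^(n-1) makes the induction close: the factor of index n
     adds at most q^n |a - b|. *)
  apply Rle_trans with (Rabs (a - b) * ((1 - q ^ n) / (1 - q))).
  - induction n as [|n IH]; simpl.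
    + rewrite Rminus_diag, Rabs_R0; lra.
    + replace (qpoch a q n * (1 - a * q ^ n) - qpoch b q n * (1 - b * q ^ n))
        with ((qpoch a q n - qpoch b q n) * (1 - a * q ^ n)
              - qpoch b q n * q ^ n * (a - b)) by ring.
      eapply Rle_trans; [apply Rabs_triang|].
      rewrite Rabs_Ropp, !Rabs_mult.
      pose proof (mult_pow_01 q a n hq (proj1 ha)).
      pose proof (qpoch_01 q b n hq hb).
      pose proof (pow_01 q n hq).
      rewrite (Rabs_pos_eq (1 - a * q ^ n)), (Rabs_pos_eq (qpoch b q n)),
        (Rabs_pos_eq (q ^ n)) by lra.
      replace ((1 - q * q ^ n) / (1 - q)) with ((1 - q ^ n) / (1 - q) + q ^ n)
        by (field; lra).
      rewrite Rmult_plus_distr_l.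
      pose proof (Rabs_pos (a - b)).
      pose proof (Rabs_pos (qpoch a q n - qpoch b q n)).
      apply Rplus_le_compat; [nra|].
      rewrite (Rmult_comm (Rabs (a - b))); apply Rmult_le_compat_r; nra.
  - unfold Rdiv; apply Rmult_le_compat_l; [apply Rabs_pos|].
    rewrite <- (Rmult_1_l (/ (1 - q))) at 2.
    apply Rmult_le_compat_r.
    + left; apply Rinv_0_lt_compat; lra.
    + pose proof (pow_01 q n hq); lra.
Qed.

Lemma qpoch_inf_lipschitz (q a b : R) :
  0 < q < 1 -> 0 <= a <= 1 -> 0 <= b <= 1 ->
  Rabs (qpoch_inf a q - qpoch_inf b q) <= Rabs (a - b) / (1 - q).
Proof.
  intros hq ha hb.
  apply (is_lim_seq_le (fun n => Rabs (qpoch a q n - qpoch b q n))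
    (fun _ => Rabs (a - b) / (1 - q))
    (Rabs (qpoch_inf a q - qpoch_inf b q)) (Rabs (a - b) / (1 - q))).
  - intros n; apply qpoch_lipschitz; assumption.
  - apply (is_lim_seq_abs _ (Finite (qpoch_inf a q - qpoch_inf b q))).
    apply is_lim_seq_minus'; apply is_lim_qpoch; lra.
  - apply is_lim_seq_const.
Qed.

Lemma qpoch_inf_0 (q : R) : qpoch_inf 0 q = 1.
Proof.
  unfold qpoch_inf; rewrite (Lim_seq_ext _ (fun _ => 1)).
  - rewrite Lim_seq_const; reflexivity.
  - intros n; induction n as [|n IH]; simpl; [reflexivity|rewrite IH; ring].
Qed.

Lemma qpoch_inf_1 (q : R) : 0 < q < 1 -> qpoch_inf 1 q = 0.
Proof. intros hq; rewrite qpoch_inf_shift by lra; ring. Qed.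

(** Finitely many positive factors are split off until the parameter of the tail is at most (1 - q)
    / 2. The Lipschitz bound against (0;q)_oo = 1 then keeps the tail at least 1/2. *)
Lemma qpoch_inf_pos (q a : R) :
  0 < q < 1 -> 0 <= a < 1 -> 0 < qpoch_inf a q.
Proof.
  intros hq ha.
  destruct (pow_eventually_small q a ((1 - q) / 2) hq (proj1 ha)) as [N hN]; [lra|].
  rewrite (qpoch_inf_split q a N) by lra.
  apply Rmult_lt_0_compat; [apply qpoch_pos; assumption|].
  pose proof (mult_pow_01 q a N hq (proj1 ha)).
  pose proof (qpoch_inf_lipschitz q (a * q ^ N) 0 hq ltac:(lra) ltac:(lra)) as h.
  rewrite qpoch_inf_0, Rminus_0_r, (Rabs_pos_eq (a * q ^ N)) in h by lra.
  assert (a * q ^ N / (1 - q) <= / 2).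
  { apply (Rmult_le_reg_r (1 - q)); [lra|].
    replace (a * q ^ N / (1 - q) * (1 - q)) with (a * q ^ N) by (field; lra); lra. }
  destruct (Rabs_le_between' (qpoch_inf (a * q ^ N) q) 1 (a * q ^ N / (1 - q)))
    as [h1 _].
  specialize (h1 h); lra.
Qed.

(** * Convolutions with q-binomial weights and the product formula *)

(** Up to the factor 1 / (q;q)_m this is a sum against q-binomial coefficients. For f i j = u i * v
    j it is the coefficient of x^m in the product of the series with coefficients u i / (q;q)_i and
    v j / (q;q)_j. *)
Definition qconv (q : R) (m : nat) (f : nat -> nat -> R) : R :=
  sum_f_R0 (fun k => f k (m - k)%nat / (qpoch q q k * qpoch q q (m - k))) m.

Lemma qconv_ext (q : R) (m : nat) (f g : nat -> nat -> R) :
  (forall i j, f i j = g i j) -> qconv q m f = qconv q m g.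
Proof. intros h; apply sum_eq; intros; rewrite h; reflexivity. Qed.

Lemma qconv_plus (q : R) (m : nat) (f g : nat -> nat -> R) :
  qconv q m (fun i j => f i j + g i j) = qconv q m f + qconv q m g.
Proof.
  unfold qconv; rewrite <- sum_plus; apply sum_eq; intros; unfold Rdiv; ring.
Qed.

Lemma qconv_scal (q c : R) (m : nat) (f : nat -> nat -> R) :
  qconv q m (fun i j => c * f i j) = c * qconv q m f.
Proof.
  unfold qconv; rewrite scal_sum; apply sum_eq; intros; unfold Rdiv; ring.
Qed.

Lemma qconv_pos (q : R) (m : nat) (f : nat -> nat -> R) :
  0 < q < 1 -> (forall i j, 0 < f i j) -> 0 < qconv q m f.
Proof.
  intros hq hf.
  apply tech1; intros k _.
  apply Rdiv_lt_0_compat; [apply hf|].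
  apply Rmult_lt_0_compat; apply qpoch_pos; lra.
Qed.

(** Split 1 - q^(m+1) as q^k (1 - q^(m+1-k)) + (1 - q^k). The first part cancels the last factor of
    (q;q)_(m+1-k) and vanishes at k = m + 1; the second cancels the last factor of (q;q)_k and
    vanishes at k = 0. *)
Lemma qconv_pascal (q : R) (m : nat) (f : nat -> nat -> R) :
  0 < q < 1 ->
  (1 - q ^ S m) * qconv q (S m) f =
  qconv q m (fun i j => q ^ i * f i (S j)) + qconv q m (fun i j => f (S i) j).
Proof.
  intros hq.
  assert (hpos : forall n, qpoch q q n <> 0)
    by (intros n; apply Rgt_not_eq, qpoch_pos; lra).
  assert (h1 : forall n, 1 - q * q ^ n <> 0).
  { intros n hn; apply (hpos (S n)); simpl; rewrite hn; ring. }
  set (w := fun k => f k (S m - k)%nat / (qpoch q q k * qpoch q q (S m - k))).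
  transitivity (sum_f_R0 (fun k => (q ^ k - q ^ S m) * w k) (S m)
                + sum_f_R0 (fun k => (1 - q ^ k) * w k) (S m)).
  { rewrite <- sum_plus; unfold qconv; rewrite scal_sum; apply sum_eq.
    intros k hk; fold (w k); ring. }
  f_equal.
  - rewrite tech5, Rminus_diag, Rmult_0_l, Rplus_0_r.
    apply sum_eq; intros k hk; unfold w.
    replace (S m - k)%nat with (S (m - k)) by lia.
    replace (q ^ S m) with (q ^ k * (q * q ^ (m - k))).
    2:{ replace (S m) with (k + S (m - k))%nat by lia.
        rewrite pow_add; reflexivity. }
    simpl; field; auto.
  - rewrite decomp_sum by lia; simpl pred.
    rewrite pow_O, Rminus_diag, Rmult_0_l, Rplus_0_l.
    apply sum_eq; intros k hk; unfold w; simpl.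
    field; auto.
Qed.

(** [q ^ i / q] stands for q^(i-1): a natural-number exponent would be truncated at i = 0. *)
Definition qpair (q a c : R) (i : nat) : R :=
  qpoch (a * c * q ^ i / q) q i * (qpoch_inf (a * q ^ i) q * qpoch_inf (c * q ^ i) q).

(** This is the recurrence that [qconv_pascal] produces in the induction step of [qconv_qpoch_inf],
    taken index by index. Once the infinite products are reduced to the parameters a q^(i+1) and c
    q^(i+1), only a polynomial identity is left. *)
Lemma qpair_pascal (q a c : R) (i : nat) :
  0 < q < 1 -> 0 < a -> 0 < c ->
  a / q * (q ^ i * qpair q a c i + qpair q a c (S i) - qpair q (a * q) c i) =
  qpair q a (c * q) i - qpair q (a / q) (c * q) i.
Proof.
  intros hq ha hc; unfold qpair.
  pose proof (pow_01 q i hq) as hs.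
  assert (haq : 0 < a / q) by (apply Rdiv_lt_0_compat; lra).
  set (z := a * c * q ^ i / q).
  pose proof (qpoch_shift z q i) as hz; simpl in hz.
  simpl pow.
  replace (a * c * (q * q ^ i) / q) with (z * q) by (unfold z; field; lra).
  replace (a * q * c * q ^ i / q) with (z * q) by (unfold z; field; lra).
  replace (a * (c * q) * q ^ i / q) with (z * q) by (unfold z; field; lra).
  replace (a / q * (c * q) * q ^ i / q) with z by (unfold z; field; lra).
  replace (a * (q * q ^ i)) with (a * q ^ i * q) by ring.
  replace (c * (q * q ^ i)) with (c * q ^ i * q) by ring.
  replace (a * q * q ^ i) with (a * q ^ i * q) by ring.
  replace (c * q * q ^ i) with (c * q ^ i * q) by ring.
  rewrite (qpoch_inf_shift q (a / q * q ^ i)) by (try assumption; nra).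
  replace (a / q * q ^ i * q) with (a * q ^ i) by (field; lra).
  rewrite (qpoch_inf_shift q (a * q ^ i)), (qpoch_inf_shift q (c * q ^ i))
    by (try assumption; nra).
  simpl.
  set (x := qpoch_inf (a * q ^ i * q) q); set (y := qpoch_inf (c * q ^ i * q) q).
  set (p := qpoch z q i) in *; set (p' := qpoch (z * q) q i) in *.
  (* The last summand is zero by [hz], the two ways of splitting (z;q)_(i+1). With it included, the
     left side matches as a polynomial identity in [p] and [p']. *)
  transitivity (x * y * (p' * (1 - a * q ^ i)
    - p * (1 - a / q * q ^ i) * (1 - a * q ^ i)
    + (1 - a * q ^ i) * (p * (1 - z * q ^ i) - (1 - z) * p'))).
  - unfold z; field; lra.
  - rewrite hz; ring.
Qed.

(* Coefficient form of [(x;q)_oo G(a;x) G(c;x) = sum_i qpair q a c i x^i / (q;q)_i],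
   by the q-binomial expansion of [1 / (x;q)_oo]. *)
Lemma qconv_qpoch_inf (q : R) (m : nat) (a c : R) :
  0 < q < 1 -> 0 < a -> 0 < c ->
  qconv q m (fun i j => qpoch_inf (a * q ^ i) q * qpoch_inf (c * q ^ j) q) =
  qconv q m (fun i _ => qpair q a c i).
Proof.
  intros hq; revert a c; induction m as [|m IH]; intros a c ha hc.
  - unfold qconv, qpair; simpl; field.
  - assert (haq : 0 < a / q) by (apply Rdiv_lt_0_compat; lra).
    assert (hm : 1 - q ^ S m <> 0).
    { simpl; pose proof (pow_01 q m hq); nra. }
    (* The factor 1 - q^(m+1) prepares the Pascal rule, and [a / q] turns its weight q^i into a
       q^(i-1). That term then becomes a difference of the pairs (a, cq) and (a/q, cq), while the
       other Pascal term gives the pair (aq, c). *)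
    apply (Rmult_eq_reg_l (a / q * (1 - q ^ S m)));
      [|apply Rmult_integral_contrapositive; split; lra].
    rewrite !Rmult_assoc, !qconv_pascal by assumption.
    pose proof (IH a (c * q) ha ltac:(nra)) as h1.
    pose proof (IH (a / q) (c * q) haq ltac:(nra)) as h2.
    pose proof (IH (a * q) c ltac:(nra) hc) as h3.
    transitivity (qconv q m (fun i _ => qpair q a (c * q) i)
      + (-1) * qconv q m (fun i _ => qpair q (a / q) (c * q) i)
      + a / q * qconv q m (fun i _ => qpair q (a * q) c i)).
    + rewrite <- h1, <- h2, <- h3.
      rewrite <- !qconv_scal, <- !qconv_plus, <- qconv_scal.
      apply qconv_ext; intros i j; simpl.
      pose proof (pow_01 q i hq).
      rewrite (qpoch_inf_shift q (a / q * q ^ i)) by (try assumption; nra).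
      replace (a / q * q ^ i * q) with (a * q ^ i) by (field; lra).
      replace (a * (q * q ^ i)) with (a * q * q ^ i) by ring.
      replace (c * (q * q ^ j)) with (c * q * q ^ j) by ring.
      field; lra.
    + rewrite <- !qconv_scal, <- !qconv_plus, <- qconv_scal.
      apply qconv_ext; intros i j.
      pose proof (qpair_pascal q a c i hq ha hc); lra.
Qed.

(** * Comparison of the pairs (bA, bB) and (b, bAB) *)

Lemma qpoch_wright (q b A B : R) (n : nat) :
  0 < q < 1 -> 0 <= b <= 1 -> 0 <= A <= 1 -> 0 <= B <= 1 ->
  qpoch b q n * qpoch (b * (A * B)) q n <= qpoch (b * A) q n * qpoch (b * B) q n.
Proof.
  intros hq hb hA hB.
  assert (hAB : 0 <= A * B <= 1) by nra.
  assert (hn : forall C, 0 <= C <= 1 -> 0 <= qpoch (b * C) q n).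
  { intros C hC; apply qpoch_01; [assumption|nra]. }
  induction n as [|n IH]; simpl; [lra|].
  (* Here [hn] speaks of [S n], while the induction hypothesis asks for the same fact at [n]. *)
  assert (hn' : forall C, 0 <= C <= 1 -> 0 <= qpoch (b * C) q n).
  { intros C hC; apply qpoch_01; [assumption|nra]. }
  specialize (IH hn').
  pose proof (mult_pow_01 q b n hq (proj1 hb)) as ht.
  set (t := b * q ^ n) in *.
  replace (b * (A * B) * q ^ n) with (t * (A * B)) by (unfold t; ring).
  replace (b * A * q ^ n) with (t * A) by (unfold t; ring).
  replace (b * B * q ^ n) with (t * B) by (unfold t; ring).
  assert (h1 : 0 <= t * A <= 1) by nra.
  assert (h2 : 0 <= t * B <= 1) by nra.
  assert (h3 : 0 <= t * ((1 - A) * (1 - B))).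
  { apply Rmult_le_pos; [lra|apply Rmult_le_pos; lra]. }
  apply Rle_trans with
    (qpoch b q n * qpoch (b * (A * B)) q n * ((1 - t * A) * (1 - t * B))).
  - replace (qpoch b q n * (1 - t) * (qpoch (b * (A * B)) q n * (1 - t * (A * B))))
      with (qpoch b q n * qpoch (b * (A * B)) q n * ((1 - t) * (1 - t * (A * B))))
      by ring.
    apply Rmult_le_compat_l.
    + apply Rmult_le_pos; [apply qpoch_01; assumption | apply hn', hAB].
    + replace ((1 - t * A) * (1 - t * B))
        with ((1 - t) * (1 - t * (A * B)) + t * ((1 - A) * (1 - B))) by ring; lra.
  - replace (qpoch (b * A) q n * (1 - t * A) * (qpoch (b * B) q n * (1 - t * B)))
      with (qpoch (b * A) q n * qpoch (b * B) q n * ((1 - t * A) * (1 - t * B)))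
      by ring.
    apply Rmult_le_compat_r; [apply Rmult_le_pos; lra | exact IH].
Qed.

(** A strict inequality need not survive the limit, so the first factors are split off. The tails,
    with [b * q] in place of [b], satisfy the weak inequality, and the first factors supply the
    strict gain b(1-A)(1-B). The case [b = 1] corresponds to mu = 0. *)
Lemma qpoch_inf_wright (q b A B : R) :
  0 < q < 1 -> 0 < b <= 1 -> 0 < A < 1 -> 0 < B < 1 ->
  qpoch_inf b q * qpoch_inf (b * (A * B)) q
  < qpoch_inf (b * A) q * qpoch_inf (b * B) q.
Proof.
  intros hq hb hA hB.
  assert (hAB : 0 < A * B < 1) by nra.
  assert (hbA : 0 < b * A < 1) by nra.
  assert (hbB : 0 < b * B < 1) by nra.
  assert (hbAB : 0 < b * (A * B) < 1) by nra.
  assert (hle : qpoch_inf (b * q) q * qpoch_inf (b * q * (A * B)) q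
                <= qpoch_inf (b * q * A) q * qpoch_inf (b * q * B) q).
  { apply (is_lim_seq_le
      (fun n => qpoch (b * q) q n * qpoch (b * q * (A * B)) q n)
      (fun n => qpoch (b * q * A) q n * qpoch (b * q * B) q n)
      (qpoch_inf (b * q) q * qpoch_inf (b * q * (A * B)) q)
      (qpoch_inf (b * q * A) q * qpoch_inf (b * q * B) q)).
    - intros n; apply qpoch_wright; nra.
    - apply is_lim_seq_mult'; apply is_lim_qpoch; nra.
    - apply is_lim_seq_mult'; apply is_lim_qpoch; nra. }
  rewrite (qpoch_inf_shift q b), (qpoch_inf_shift q (b * (A * B))),
    (qpoch_inf_shift q (b * A)), (qpoch_inf_shift q (b * B)) by lra.
  replace (b * (A * B) * q) with (b * q * (A * B)) by ring.
  replace (b * A * q) with (b * q * A) by ring.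
  replace (b * B * q) with (b * q * B) by ring.
  assert (hX : 0 < qpoch_inf (b * q * A) q * qpoch_inf (b * q * B) q).
  { apply Rmult_lt_0_compat; apply qpoch_inf_pos; nra. }
  set (X := qpoch_inf (b * q * A) q) in *; set (Y := qpoch_inf (b * q * B) q) in *.
  set (Z := qpoch_inf (b * q) q) in *; set (W := qpoch_inf (b * q * (A * B)) q) in *.
  assert (h0 : 0 < b * ((1 - A) * (1 - B))).
  { apply Rmult_lt_0_compat; [lra|apply Rmult_lt_0_compat; lra]. }
  apply Rle_lt_trans with (X * Y * ((1 - b) * (1 - b * (A * B)))).
  - replace ((1 - b) * Z * ((1 - b * (A * B)) * W))
      with (Z * W * ((1 - b) * (1 - b * (A * B)))) by ring.
    apply Rmult_le_compat_r; [apply Rmult_le_pos; lra | exact hle].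
  - replace ((1 - b * A) * X * ((1 - b * B) * Y))
      with (X * Y * ((1 - b) * (1 - b * (A * B)) + b * ((1 - A) * (1 - B)))) by ring.
    apply Rmult_lt_compat_l; [exact hX | lra].
Qed.

Lemma qpair_wright (q b A B : R) (i : nat) :
  0 < q < 1 -> 0 < b <= 1 -> 0 < A < 1 -> 0 < B < 1 ->
  qpair q b (b * (A * B)) i < qpair q (b * A) (b * B) i.
Proof.
  intros hq hb hA hB; unfold qpair.
  replace (b * A * (b * B) * q ^ i / q) with (b * (b * (A * B)) * q ^ i / q)
    by (field; lra).
  apply Rmult_lt_compat_l.
  (* At i = 0 the parameter b^2 AB / q may exceed 1, but the product is empty. *)
  - destruct i as [|i]; [simpl; lra|].
    replace (b * (b * (A * B)) * q ^ S i / q) with (b * (b * (A * B)) * q ^ i)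
      by (simpl; field; lra).
    assert (hAB : 0 < A * B < 1) by nra.
    assert (h : 0 < b * (A * B) < 1) by nra.
    assert (h' : 0 < b * (b * (A * B)) < 1) by nra.
    pose proof (mult_pow_01 q (b * (b * (A * B))) i hq ltac:(lra)).
    apply qpoch_pos; lra.
  - pose proof (pow_01 q i hq).
    replace (b * (A * B) * q ^ i) with (b * q ^ i * (A * B)) by ring.
    replace (b * A * q ^ i) with (b * q ^ i * A) by ring.
    replace (b * B * q ^ i) with (b * q ^ i * B) by ring.
    apply qpoch_inf_wright; nra.
Qed.

(** * Power series coefficients and their convergence *)

Definition ftilde_coef (q b : R) (n : nat) : R :=
  qpoch_inf (b * q ^ n) q / qpoch q q n.

Definition turan_coef (q b A B : R) (m : nat) : R :=
  PS_mult (ftilde_coef q (b * A)) (ftilde_coef q (b * B)) m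
  - PS_mult (ftilde_coef q b) (ftilde_coef q (b * (A * B))) m.

Lemma PS_mult_ftilde_coef (q a c : R) (m : nat) :
  0 < q < 1 -> 0 < a -> 0 < c ->
  PS_mult (ftilde_coef q a) (ftilde_coef q c) m = qconv q m (fun i _ => qpair q a c i).
Proof.
  intros hq ha hc; rewrite <- qconv_qpoch_inf by assumption.
  unfold PS_mult, qconv, ftilde_coef; apply sum_eq; intros k hk.
  assert (hpos : forall n, qpoch q q n <> 0)
    by (intros n; apply Rgt_not_eq, qpoch_pos; lra).
  field; auto.
Qed.

Lemma turan_coef_pos (q b A B : R) (m : nat) :
  0 < q < 1 -> 0 < b <= 1 -> 0 < A < 1 -> 0 < B < 1 -> 0 < turan_coef q b A B m.
Proof.
  intros hq hb hA hB; unfold turan_coef.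
  assert (hAB : 0 < A * B < 1) by nra.
  rewrite !PS_mult_ftilde_coef by (try assumption; nra).
  replace (_ - _) with
    (qconv q m (fun i _ => qpair q (b * A) (b * B) i + -1 * qpair q b (b * (A * B)) i))
    by (rewrite qconv_plus, qconv_scal; ring).
  apply qconv_pos; [assumption|]; intros i _.
  pose proof (qpair_wright q b A B i hq hb hA hB); lra.
Qed.

(** This bound, uniform in n, keeps the coefficients of G(b;x) bounded, which yields a radius of
    convergence of at least 1. *)
Lemma inv_qpoch_le (q : R) (n : nat) :
  0 < q < 1 -> 0 < / qpoch q q n <= / qpoch_inf q q.
Proof.
  intros hq.
  assert (h := qpoch_pos q q n hq ltac:(lra)).
  split; [apply Rinv_0_lt_compat, h|].
  apply Rinv_le_contravar; [apply qpoch_inf_pos; lra|].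
  rewrite (qpoch_inf_split q q n) by lra.
  pose proof (mult_pow_01 q q n hq ltac:(lra)).
  pose proof (qpoch_inf_01 q (q * q ^ n) hq ltac:(lra)); nra.
Qed.

Lemma ftilde_coef_bounds (q b : R) (n : nat) :
  0 < q < 1 -> 0 <= b <= 1 -> 0 <= ftilde_coef q b n <= / qpoch_inf q q.
Proof.
  intros hq hb; unfold ftilde_coef, Rdiv.
  pose proof (inv_qpoch_le q n hq).
  pose proof (mult_pow_01 q b n hq (proj1 hb)).
  pose proof (qpoch_inf_01 q (b * q ^ n) hq ltac:(lra)); nra.
Qed.

Lemma CV_radius_ftilde_coef (q b x : R) :
  0 < q < 1 -> 0 <= b <= 1 -> Rabs x < 1 ->
  Rbar_lt (Rabs x) (CV_radius (ftilde_coef q b)).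
Proof.
  intros hq hb hx; apply Rbar_lt_le_trans with 1; [exact hx|].
  apply (proj1 (CV_radius_bounded (ftilde_coef q b))).
  exists (/ qpoch_inf q q); intros n.
  rewrite pow1, Rmult_1_r.
  pose proof (ftilde_coef_bounds q b n hq hb).
  rewrite Rabs_pos_eq; lra.
Qed.

Lemma is_pseries_ftilde_coef (q b x : R) :
  0 < q < 1 -> 0 <= b <= 1 -> Rabs x < 1 ->
  is_pseries (ftilde_coef q b) x (PSeries (ftilde_coef q b) x).
Proof.
  intros hq hb hx; apply PSeries_correct, CV_radius_inside.
  apply CV_radius_ftilde_coef; assumption.
Qed.

Lemma is_pseries_turan_coef (q b A B x : R) :
  0 < q < 1 -> 0 < b <= 1 -> 0 < A < 1 -> 0 < B < 1 -> Rabs x < 1 ->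
  is_pseries (turan_coef q b A B) x
    (PSeries (ftilde_coef q (b * A)) x * PSeries (ftilde_coef q (b * B)) x
     - PSeries (ftilde_coef q b) x * PSeries (ftilde_coef q (b * (A * B))) x).
Proof.
  intros hq hb hA hB hx.
  assert (hAB : 0 < A * B < 1) by nra.
  apply (is_pseries_minus (PS_mult _ _) (PS_mult _ _));
    apply is_pseries_mult;
    (apply is_pseries_ftilde_coef || apply CV_radius_ftilde_coef); nra.
Qed.

(** * Reduction of [ftilde] to G(q^mu;x) *)

Definition ftilde_const (q mu : R) : R := Rpower (1 - q) (mu - 1) / qpoch_inf q q.

Lemma Rpower_q_01 (q mu : R) : 0 < q < 1 -> 0 < mu -> 0 < Rpower q mu < 1.
Proof.
  intros hq hmu; unfold Rpower; split; [apply exp_pos|].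
  rewrite <- exp_0; apply exp_increasing.
  pose proof (ln_increasing q 1 ltac:(lra) ltac:(lra)) as h; rewrite ln_1 in h; nra.
Qed.

Lemma Rpower_q_01_le (q mu : R) : 0 < q < 1 -> 0 <= mu -> 0 < Rpower q mu <= 1.
Proof.
  intros hq [hmu|<-].
  - pose proof (Rpower_q_01 q mu hq hmu); lra.
  - rewrite Rpower_O; lra.
Qed.

(** One formula covers the pole too: at z = 0 the factor (1;q)_oo vanishes, in agreement with the
    convention 1 / Gamma_q(0) = 0. *)
Lemma inv_qGammaE (q z : R) :
  0 < q < 1 -> 0 <= z ->
  inv_qGamma q z = ftilde_const q z * qpoch_inf (Rpower q z) q.
Proof.
  intros hq hz; unfold inv_qGamma, ftilde_const.
  destruct (Req_EM_T z 0) as [->|hz0].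
  - rewrite Rpower_O, qpoch_inf_1 by lra; ring.
  - unfold qGamma.
    replace (z - 1) with (- (1 - z)) by ring; rewrite Rpower_Ropp.
    pose proof (qpoch_inf_pos q q hq ltac:(lra)).
    pose proof (Rpower_q_01 q z hq ltac:(lra)).
    pose proof (qpoch_inf_pos q (Rpower q z) hq ltac:(lra)).
    assert (0 < Rpower (1 - q) (1 - z)) by apply exp_pos.
    field; lra.
Qed.

Lemma ftildeE (q mu x : R) :
  0 < q < 1 -> 0 <= mu ->
  ftilde q mu x = ftilde_const q mu * PSeries (ftilde_coef q (Rpower q mu)) x.
Proof.
  intros hq hmu; unfold ftilde, PSeries; rewrite <- Series_scal_l.
  apply Series_ext; intros n.
  pose proof (pos_INR n).
  pose proof (qpoch_pos q q n hq ltac:(lra)).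
  pose proof (qpoch_inf_pos q q hq ltac:(lra)).
  rewrite inv_qGammaE by (try assumption; lra).
  unfold ftilde_const, ftilde_coef.
  replace (mu + INR n - 1) with (mu - 1 + INR n) by ring.
  rewrite !Rpower_plus, !Rpower_pow by lra.
  unfold Rdiv; rewrite Rpow_mult_distr, pow_inv.
  assert ((1 - q) ^ n <> 0) by (apply pow_nonzero; lra).
  field; repeat split; try assumption; lra.
Qed.

(** Termwise, (q^mu;q)_oo / (q^mu;q)_n = (q^(mu+n);q)_oo. *)
Lemma heine00_div_qGamma (q mu x : R) :
  0 < q < 1 -> 0 < mu ->
  heine00 q (Rpower q mu) x / qGamma q mu = ftilde q mu x.
Proof.
  intros hq hmu; rewrite ftildeE by lra.
  pose proof (Rpower_q_01 q mu hq hmu) as hb.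
  replace (heine00 q (Rpower q mu) x / qGamma q mu)
    with (inv_qGamma q mu * heine00 q (Rpower q mu) x).
  2:{ unfold inv_qGamma; destruct (Req_EM_T mu 0); [lra|unfold Rdiv; ring]. }
  rewrite inv_qGammaE by lra; rewrite Rmult_assoc; f_equal.
  unfold heine00, PSeries; rewrite <- Series_scal_l.
  apply Series_ext; intros n; unfold ftilde_coef.
  rewrite (qpoch_inf_split q _ n) by lra.
  pose proof (qpoch_pos q q n hq ltac:(lra)).
  pose proof (qpoch_pos q (Rpower q mu) n hq ltac:(lra)).
  field; lra.
Qed.

Lemma ftilde_const_pos (q mu : R) : 0 < q < 1 -> 0 < ftilde_const q mu.
Proof.
  intros hq; apply Rdiv_lt_0_compat; [apply exp_pos|apply qpoch_inf_pos; lra].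
Qed.

(** The value mu = 0 is included because log-concavity is claimed up to that endpoint. *)
Lemma is_pseries_turanian_ftilde (q mu alpha beta x : R) :
  0 < q < 1 -> 0 <= mu -> 0 < alpha -> 0 < beta -> Rabs x < 1 ->
  is_pseries
    (PS_scal (ftilde_const q mu * ftilde_const q (mu + alpha + beta))
       (turan_coef q (Rpower q mu) (Rpower q alpha) (Rpower q beta)))
    x (turanian (ftilde q) mu alpha beta x).
Proof.
  intros hq hmu ha hb hx; unfold turanian.
  rewrite !ftildeE by lra.
  (* Since [ftilde_const] is exponential in mu, its product at two points depends only on their sum;
     both products in the Turánian carry the same constant. *)
  assert (hK : ftilde_const q (mu + alpha) * ftilde_const q (mu + beta)
               = ftilde_const q mu * ftilde_const q (mu + alpha + beta)).
  { unfold ftilde_const.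
    replace (mu + alpha - 1) with (mu - 1 + alpha) by ring.
    replace (mu + beta - 1) with (mu - 1 + beta) by ring.
    replace (mu + alpha + beta - 1) with (mu - 1 + alpha + beta) by ring.
    rewrite !Rpower_plus; unfold Rdiv; ring. }
  pose proof (is_pseries_turan_coef q (Rpower q mu) (Rpower q alpha) (Rpower q beta) x
    hq (Rpower_q_01_le q mu hq hmu) (Rpower_q_01 q alpha hq ha)
    (Rpower_q_01 q beta hq hb) hx) as h.
  rewrite <- !Rmult_assoc, <- !Rpower_plus in h.
  apply (is_pseries_scal (ftilde_const q mu * ftilde_const q (mu + alpha + beta)))
    in h; [|apply Rmult_comm].
  match type of h with is_pseries _ _ ?l =>
    match goal with |- is_pseries _ _ ?r => replace r with l; [exact h|] end end.
  match goal with |- scal ?k ?l = ?r => change (k * l = r :> R) end.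
  rewrite Rmult_minus_distr_l; rewrite <- hK at 1; ring.
Qed.

(** * Positivity for 0 < x < 1 *)

(** From index [k] on, every partial sum is at least [c k * x ^ k], a positive bound that passes to
    the limit. *)
Lemma is_pseries_pos (c : nat -> R) (x l : R) (k : nat) :
  0 < x -> (forall n, 0 <= c n) -> 0 < c k -> is_pseries c x l -> 0 < l.
Proof.
  intros hx hc hk h; apply is_pseries_R in h.
  assert (ht : forall n, 0 <= c n * x ^ n).
  { intros n; apply Rmult_le_pos; [apply hc|left; apply pow_lt, hx]. }
  assert (hs : forall n, 0 <= sum_n (fun n => c n * x ^ n) n).
  { intros n; induction n as [|n IH]; [rewrite sum_O; apply ht|].
    rewrite sum_Sn; change plus with Rplus; pose proof (ht (S n)); lra. }
  apply Rlt_le_trans with (c k * x ^ k);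
    [apply Rmult_lt_0_compat; [exact hk|apply pow_lt, hx]|].
  apply (is_lim_seq_le_loc (fun _ => c k * x ^ k) (sum_n (fun n => c n * x ^ n))
    (c k * x ^ k) l); [|apply is_lim_seq_const|exact h].
  exists k; intros n hn; induction hn as [|n hn IH].
  - destruct k as [|k]; [rewrite sum_O; apply Rle_refl|].
    rewrite sum_Sn; change plus with Rplus; pose proof (hs k); lra.
  - rewrite sum_Sn; change plus with Rplus; pose proof (ht (S n)); lra.
Qed.

Lemma turanian_ftilde_coef_pos (q mu alpha beta : R) (n : nat) :
  0 < q < 1 -> 0 <= mu -> 0 < alpha -> 0 < beta ->
  0 < PS_scal (ftilde_const q mu * ftilde_const q (mu + alpha + beta))
        (turan_coef q (Rpower q mu) (Rpower q alpha) (Rpower q beta)) n.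
Proof.
  intros hq hmu ha hb; unfold PS_scal; change scal with Rmult.
  apply Rmult_lt_0_compat.
  - apply Rmult_lt_0_compat; apply ftilde_const_pos, hq.
  - apply turan_coef_pos; auto using Rpower_q_01, Rpower_q_01_le.
Qed.

Lemma turanian_ftilde_pos (q mu alpha beta x : R) :
  0 < q < 1 -> 0 <= mu -> 0 < alpha -> 0 < beta -> 0 < x < 1 ->
  0 < turanian (ftilde q) mu alpha beta x.
Proof.
  intros hq hmu ha hb hx.
  pose proof (fun n => turanian_ftilde_coef_pos q mu alpha beta n hq hmu ha hb) as hc.
  eapply (is_pseries_pos _ x _ 0).
  - apply hx.
  - intros n; apply Rlt_le, hc.
  - apply hc.
  - apply is_pseries_turanian_ftilde; try assumption; rewrite Rabs_pos_eq; lra.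
Qed.

Lemma PSeries_ftilde_coef_pos (q b x : R) :
  0 < q < 1 -> 0 < b <= 1 -> 0 < x < 1 -> 0 < PSeries (ftilde_coef q b) x.
Proof.
  intros hq hb hx.
  (* Index 1 is used because the constant coefficient (b;q)_oo is zero at [b = 1]. *)
  apply (is_pseries_pos (ftilde_coef q b) x _ 1).
  - apply hx.
  - intros n; apply ftilde_coef_bounds; lra.
  - unfold ftilde_coef; apply Rdiv_lt_0_compat; [apply qpoch_inf_pos|apply qpoch_pos]; nra.
  - apply is_pseries_ftilde_coef; [assumption|lra|rewrite Rabs_pos_eq; lra].
Qed.

Lemma ftilde_pos (q mu x : R) :
  0 < q < 1 -> 0 <= mu -> 0 < x < 1 -> 0 < ftilde q mu x.
Proof.
  intros hq hmu hx; rewrite ftildeE by assumption.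
  apply Rmult_lt_0_compat; [apply ftilde_const_pos, hq|].
  apply PSeries_ftilde_coef_pos; try assumption; apply Rpower_q_01_le; assumption.
Qed.

(** * Continuity in mu and log-concavity *)

(** The n-th terms differ by at most a constant times |b - b'| x^n, by the Lipschitz bound for the
    infinite product; summing the geometric series gives the factor 1 / (1 - x). Continuity in mu
    follows through b = q^mu. *)
Lemma PSeries_ftilde_coef_lipschitz (q b b' x : R) :
  0 < q < 1 -> 0 <= b <= 1 -> 0 <= b' <= 1 -> 0 <= x < 1 ->
  Rabs (PSeries (ftilde_coef q b) x - PSeries (ftilde_coef q b') x)
  <= / (qpoch_inf q q * (1 - q) * (1 - x)) * Rabs (b - b').
Proof.
  intros hq hb hb' hx.
  assert (hx' : Rabs x < 1) by (rewrite Rabs_pos_eq; lra).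
  assert (hphi := qpoch_inf_pos q q hq ltac:(lra)).
  assert (hs : forall c, 0 <= c <= 1 -> ex_series (fun n => ftilde_coef q c n * x ^ n)).
  { intros c hc; eexists; apply is_pseries_R, is_pseries_ftilde_coef; eassumption. }
  unfold PSeries; rewrite <- Series_minus by auto.
  set (d := fun n => _ - _).
  set (K := / qpoch_inf q q * (Rabs (b - b') / (1 - q))).
  assert (hd : forall n, 0 <= Rabs (d n) <= K * x ^ n).
  { intros n; split; [apply Rabs_pos|]; unfold d, K, ftilde_coef.
    replace (qpoch_inf (b * q ^ n) q / qpoch q q n * x ^ n
             - qpoch_inf (b' * q ^ n) q / qpoch q q n * x ^ n)
      with (/ qpoch q q n * (qpoch_inf (b * q ^ n) q - qpoch_inf (b' * q ^ n) q) * x ^ n)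
      by (unfold Rdiv; ring).
    pose proof (inv_qpoch_le q n hq).
    assert (0 <= x ^ n) by (apply pow_le; lra).
    rewrite !Rabs_mult, (Rabs_pos_eq (x ^ n)), (Rabs_pos_eq (/ qpoch q q n)) by lra.
    apply Rmult_le_compat_r; [assumption|].
    apply Rmult_le_compat; [lra|apply Rabs_pos|lra|].
    pose proof (mult_pow_01 q b n hq (proj1 hb)).
    pose proof (mult_pow_01 q b' n hq (proj1 hb')).
    eapply Rle_trans; [apply qpoch_inf_lipschitz; lra|].
    unfold Rdiv; apply Rmult_le_compat_r; [left; apply Rinv_0_lt_compat; lra|].
    rewrite <- Rmult_minus_distr_r, Rabs_mult.
    pose proof (pow_01 q n hq); rewrite (Rabs_pos_eq (q ^ n)) by lra.
    pose proof (Rabs_pos (b - b')); nra. }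
  assert (hK : is_series (fun n => K * x ^ n) (K * / (1 - x))).
  { apply (is_series_scal_l K (fun n => x ^ n)), is_series_geom, hx'. }
  replace (/ (qpoch_inf q q * (1 - q) * (1 - x)) * Rabs (b - b')) with (K * / (1 - x))
    by (unfold K; field; lra).
  rewrite <- (is_series_unique _ _ hK).
  assert (hex : ex_series (fun n => K * x ^ n)) by (eexists; exact hK).
  eapply Rle_trans; [apply Series_Rabs|apply Series_le; assumption].
  apply (@ex_series_le R_AbsRing R_CompleteNormedModule _ (fun n => K * x ^ n));
    [|exact hex].
  intros n; change norm with Rabs; rewrite Rabs_Rabsolu; apply hd.
Qed.

Lemma lipschitz_comp_continuity_pt (F f : R -> R) (D : R -> Prop) (K s : R) :
  (forall t, D (f t)) ->
  (forall a b, D a -> D b -> Rabs (F a - F b) <= K * Rabs (a - b)) ->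
  continuity_pt f s -> continuity_pt (fun t => F (f t)) s.
Proof.
  intros hD hF hf e he.
  (* [Rabs K + 1] is a positive Lipschitz constant whatever the sign of [K]. *)
  assert (hK : 0 < Rabs K + 1) by (pose proof (Rabs_pos K); lra).
  destruct (hf (e / (Rabs K + 1))) as [d [hd h]]; [apply Rdiv_lt_0_compat; assumption|].
  exists d; split; [exact hd|]; intros t ht; specialize (h t ht).
  change (Rabs (F (f t) - F (f s)) < e).
  change (Rabs (f t - f s) < e / (Rabs K + 1)) in h.
  apply (Rmult_lt_compat_r (Rabs K + 1)) in h; [|exact hK].
  replace (e / (Rabs K + 1) * (Rabs K + 1)) with e in h by (field; lra).
  specialize (hF _ _ (hD t) (hD s)).
  pose proof (Rabs_pos (f t - f s)); pose proof (Rle_abs K); nra.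
Qed.

Lemma continuity_pt_Rpower (a : R) (f : R -> R) (s : R) :
  continuity_pt f s -> continuity_pt (fun t => Rpower a (f t)) s.
Proof.
  intros hf; unfold Rpower.
  apply (continuity_pt_comp (fun t => f t * ln a) exp).
  - apply (continuity_pt_mult f (fun _ => ln a)); [exact hf|].
    apply continuity_pt_const; intros ? ?; reflexivity.
  - apply derivable_continuous_pt, derivable_pt_exp.
Qed.

Lemma continuity_pt_ln_ftilde (q x : R) (f : R -> R) (s : R) :
  0 < q < 1 -> 0 < x < 1 -> (forall t, 0 <= f t) ->
  continuity_pt f s -> continuity_pt (fun t => ln (ftilde q (f t) x)) s.
Proof.
  intros hq hx hf hc.
  apply (continuity_pt_comp (fun t => ftilde q (f t) x) ln).
  - apply continuity_pt_ext with (fun t => Rpower (1 - q) (f t - 1) * / qpoch_inf q q *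
      PSeries (ftilde_coef q (Rpower q (f t))) x).
    { intros t; rewrite ftildeE by auto; reflexivity. }
    assert (hcst : forall c, continuity_pt (fun _ => c) s).
    { intros c; apply continuity_pt_const; intros ? ?; reflexivity. }
    apply continuity_pt_mult; [apply continuity_pt_mult|].
    + apply continuity_pt_Rpower, continuity_pt_minus; [exact hc|apply hcst].
    + apply hcst.
    + eapply (lipschitz_comp_continuity_pt (fun b => PSeries (ftilde_coef q b) x)
        (fun t => Rpower q (f t)) (fun b => 0 < b <= 1)).
      * intros t; apply Rpower_q_01_le; auto.
      * intros a b ha hb; apply PSeries_ftilde_coef_lipschitz; lra.
      * apply continuity_pt_Rpower, hc.
  - apply derivable_continuous_pt; exists (/ ftilde q (f s) x).
    apply derivable_pt_lim_ln, ftilde_pos; auto.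
Qed.

(* At a minimizer of [k], the midpoint inequality with the nearest endpoint and
   its reflection forces [k >= 0]. *)
Lemma midpoint_concave_ge0 (k : R -> R) :
  (forall s, 0 <= s <= 1 -> continuity_pt k s) ->
  (forall a b, 0 <= a <= 1 -> 0 <= b <= 1 -> k a + k b <= 2 * k ((a + b) / 2)) ->
  k 0 = 0 -> k 1 = 0 -> forall t, 0 <= t <= 1 -> 0 <= k t.
Proof.
  intros hc hm h0 h1 t ht.
  destruct (continuity_ab_min k 0 1 Rle_0_1 hc) as [s [hs hs']].
  apply Rle_trans with (k s); [|apply hs, ht].
  destruct (Rle_dec s (1 / 2)) as [h|h].
  - pose proof (hs (2 * s) ltac:(lra)).
    pose proof (hm 0 (2 * s) ltac:(lra) ltac:(lra)) as h2.
    replace ((0 + 2 * s) / 2) with s in h2 by field; lra.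
  - pose proof (hs (2 * s - 1) ltac:(lra)).
    pose proof (hm 1 (2 * s - 1) ltac:(lra) ltac:(lra)) as h2.
    replace ((1 + (2 * s - 1)) / 2) with s in h2 by field; lra.
Qed.

Lemma ln_ftilde_midpoint (q u v x : R) :
  0 < q < 1 -> 0 <= u -> 0 <= v -> 0 < x < 1 ->
  ln (ftilde q u x) + ln (ftilde q v x) <= 2 * ln (ftilde q ((u + v) / 2) x).
Proof.
  intros hq hu hv hx.
  assert (hlt : forall u v, 0 <= u -> u < v ->
    ln (ftilde q u x) + ln (ftilde q v x) <= 2 * ln (ftilde q ((u + v) / 2) x)).
  { clear u v hu hv; intros u v hu huv.
    (* With both shifts equal to half the distance, the Turánian is the squared midpoint value minus
       the product of the endpoint values. *)
    pose proof (turanian_ftilde_pos q u ((v - u) / 2) ((v - u) / 2) x hq hu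
      ltac:(lra) ltac:(lra) hx) as h.
    unfold turanian in h.
    replace (u + (v - u) / 2 + (v - u) / 2) with v in h by field.
    replace (u + (v - u) / 2) with ((u + v) / 2) in h by field.
    pose proof (ftilde_pos q u x hq hu hx).
    pose proof (ftilde_pos q v x hq ltac:(lra) hx).
    pose proof (ftilde_pos q ((u + v) / 2) x hq ltac:(lra) hx).
    rewrite <- ln_mult by assumption.
    replace (2 * ln (ftilde q ((u + v) / 2) x))
      with (ln (ftilde q ((u + v) / 2) x * ftilde q ((u + v) / 2) x))
      by (rewrite ln_mult by assumption; ring).
    left; apply ln_increasing; [apply Rmult_lt_0_compat; assumption|lra]. }
  destruct (Rtotal_order u v) as [h|[h|h]].
  - apply hlt; assumption.
  - subst v; replace ((u + u) / 2) with u by field; lra.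
  - rewrite Rplus_comm, (Rplus_comm u); apply hlt; assumption.
Qed.

Lemma ftilde_log_concave (q x : R) :
  0 < q < 1 -> 0 < x < 1 ->
  log_concave_on (fun mu => 0 <= mu) (fun mu => ftilde q mu x).
Proof.
  intros hq hx; split; [intros u hu; apply ftilde_pos; assumption|].
  intros u v t hu hv ht.
  (* [continuity_pt] is two-sided, so at [s = 0] and [s = 1] the argument has to
     stay nonnegative for [s] outside [0, 1] as well. *)
  set (p := fun s => Rabs (s * u + (1 - s) * v)).
  assert (hp : forall s, 0 <= s <= 1 -> p s = s * u + (1 - s) * v).
  { intros s hs; apply Rabs_pos_eq; nra. }
  (* [L] is the chord. Subtracting it preserves midpoint concavity and makes the difference vanish
     at both ends, as [midpoint_concave_ge0] requires. *)
  set (L := fun s => s * ln (ftilde q u x) + (1 - s) * ln (ftilde q v x)).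
  enough (h : 0 <= ln (ftilde q (p t) x) - L t) by (rewrite hp in h; unfold L in h; lra).
  apply (midpoint_concave_ge0 (fun s => ln (ftilde q (p s) x) - L s)); [| | | |exact ht].
  - intros s _; apply continuity_pt_minus.
    + apply continuity_pt_ln_ftilde; try assumption; [intros; apply Rabs_pos|].
      apply (continuity_pt_comp (fun s => s * u + (1 - s) * v) Rabs);
        [reg|apply Rcontinuity_abs].
    + unfold L; reg.
  - intros a b ha hb.
    pose proof (ln_ftilde_midpoint q (p a) (p b) x hq (Rabs_pos _) (Rabs_pos _) hx) as h.
    (* On [0, 1] the map [p] is affine, so it sends midpoints to midpoints. *)
    replace ((p a + p b) / 2) with (p ((a + b) / 2)) in h
      by (rewrite !hp by lra; field).
    unfold L; lra.
  - rewrite hp by lra; unfold L.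
    replace (0 * u + (1 - 0) * v) with v by ring; ring.
  - rewrite hp by lra; unfold L.
    replace (1 * u + (1 - 1) * v) with u by ring; ring.
Qed.

Theorem theorem3 (q : R) (hq : 0 < q < 1) :
  (forall mu x : R, 0 < mu -> Rabs x < 1 ->
     heine00 q (Rpower q mu) x / qGamma q mu = ftilde q mu x) /\
  (forall mu alpha beta : R, 0 < mu -> 0 < alpha -> 0 < beta ->
     exists c : nat -> R,
       (forall x : R, Rabs x < 1 ->
          is_pseries c x (turanian (ftilde q) mu alpha beta x)) /\
       (forall m : nat, 0 < c m)) /\
  (forall x : R, 0 < x < 1 ->
     log_concave_on (fun mu => 0 <= mu) (fun mu => ftilde q mu x)).
Proof.
  split; [|split].
  - intros mu x hmu _; apply heine00_div_qGamma; assumption.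
  (* The coefficient sequence is left open before [x] is introduced, so it cannot depend on [x];
     unification with [is_pseries_turanian_ftilde] supplies it. *)
  - intros mu alpha beta hmu ha hb; eexists; split.
    + intros x hx; apply is_pseries_turanian_ftilde; lra.
    + intros m; apply turanian_ftilde_coef_pos; lra.
  - intros x hx; apply ftilde_log_concave; assumption.
Qed.
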